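(* Consider the following randomized algorithm for generalized min-sum set cover on an instance $(U,\mathcal{S},K)$ with $|U|=n$. Compute an optimal solution $x^*,y^*$ of the LP described in the context. Choose $\alpha\in(0,1)$ at random with density $f(\alpha)=2\alpha$, and set $Q:=z/\alpha$ for a constant $z>0$. Construct $x$ from $x^*$ by setting $x:=Q\cdot x^*$ and then, for $t=1,\dots,\lfloor n/2\rfloor$ in this order, setting $x_{e,2t}:=x_{e,2t}+x_{e,t}$ for all $e\in U$. For each $e\in U$ choose $\alpha_e\in[0,1]$ independently and uniformly at random (independently of $\alpha$), let $t_{e,\alpha_e}$ be the first $t\in[n]$ with $\sum_{t'=1}^t x_{e,t'}\ge\alpha_e$, and output the ordering of $U$ by nondecreasing $t_{e,\alpha_e}$ (ties broken arbitrarily). Then there is a constant $z>0$ for which this algorithm has performance guarantee less than $27.78$; that is, for every instance the expected value of $\sum_{S\in\mathcal{S}}C_S$ of the output ordering is at most $\rho\cdot OPT$ for some constant $\rho<27.78$, where $OPT$ is the optimal objective value.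
   Context: Generalized min-sum set cover: given a universe $U$ of $n$ elements, a collection $\mathcal{S}$ of subsets of $U$, and for each $S\in\mathcal{S}$ an integer $K(S)\in\{1,\dots,|S|\}$. A solution is an ordering of $U$; $C_S$ is the position of the $K(S)$-th element of $S$; the goal is to minimize $\sum_S C_S$. $[n]=\{1,\dots,n\}$. The LP: minimize $\sum_{t\in[n]}\sum_{S\in\mathcal{S}}(1-y_{S,t})$ subject to $\sum_{e\in U}x_{e,t}=1$ for all $t\in[n]$; $\sum_{t\in[n]}x_{e,t}=1$ for all $e\in U$; $\sum_{e\in S\setminus A}\sum_{t'<t}x_{e,t'}\ge (K(S)-|A|)\,y_{S,t}$ for all $S\in\mathcal{S}$, $A\subseteq S$, $t\in[n]$; $x_{e,t},y_{S,t}\in[0,1]$. *)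

(* Defs.v *)
From HB Require Export structures.
From mathcomp Require Export all_boot all_order all_algebra.
From mathcomp Require Export all_classical all_reals all_analysis.

Set Implicit Arguments.
Unset Strict Implicit.
Unset Printing Implicit Defensive.

Import Order.TTheory GRing.Theory Num.Theory.
Import numFieldNormedType.Exports.

Local Open Scope classical_set_scope.
Local Open Scope ring_scope.

(* The universe is a finite type U with n = #|U|.  Times and positions are
   1-based natural numbers: [n] is the range 1 <= t < n.+1. *)

Section Problem.
Variables (U : finType) (SS : {set {set U}}) (K : {set U} -> nat).

Definition gmssc_instance : Prop :=
  forall S, S \in SS -> (1 <= K S <= #|S|)%N.

(* A duplicate-free tuple of length #|U| lists every element of U exactly
   once. *)
Definition is_ordering (s : #|U|.-tuple U) : bool := uniq s.

(* [seq e <- s | e \in S] lists the elements of S in the order given by s;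
   its entry number (K S).-1 (counting from 0) is the K(S)-th element of S. *)
Definition cover_time (s : #|U|.-tuple U) (S : {set U}) : nat :=
  nth 0%N [seq (index e s).+1 | e <- s & e \in S] (K S).-1.

Definition cost (s : #|U|.-tuple U) : nat := (\sum_(S in SS) cover_time s S)%N.

Definition OPT : nat :=
  cost [arg min_(s < enum_tuple U | is_ordering s) cost s]%N.

Lemma OPTP :
  (exists2 s, is_ordering s & cost s = OPT) /\
  (forall s, is_ordering s -> (OPT <= cost s)%N).
Proof.
rewrite /OPT; case: arg_minnP => [|s us smin]; first exact: enum_uniq.
by split=> //; exists s.
Qed.

End Problem.

Section LinearProgram.
Variables (R : realType) (U : finType).
Variables (SS : {set {set U}}) (K : {set U} -> nat).

(* Only the values x e t and y S t with S \in SS and 1 <= t <= #|U| are LP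
   variables; all other values are irrelevant. *)
Record lp_feasible (x : U -> nat -> R) (y : {set U} -> nat -> R) : Prop := {
  lp_time : forall t, (1 <= t <= #|U|)%N -> \sum_(e : U) x e t = 1;
  lp_elem : forall e, \sum_(1 <= t < #|U|.+1) x e t = 1;
  lp_cover : forall S (A : {set U}) t, S \in SS -> A \subset S ->
    (1 <= t <= #|U|)%N ->
    ((K S)%:R - #|A|%:R) * y S t
      <= \sum_(e in S :\: A) \sum_(1 <= t' < t) x e t';
  lp_x_bounds : forall e t, (1 <= t <= #|U|)%N -> 0 <= x e t <= 1;
  lp_y_bounds : forall S t, S \in SS -> (1 <= t <= #|U|)%N -> 0 <= y S t <= 1
}.

Definition lp_value (y : {set U} -> nat -> R) : R :=
  \sum_(1 <= t < #|U|.+1) \sum_(S in SS) (1 - y S t).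

Definition lp_optimal (x : U -> nat -> R) (y : {set U} -> nat -> R) : Prop :=
  lp_feasible x y /\
  forall x' y', lp_feasible x' y' -> lp_value y <= lp_value y'.

End LinearProgram.

Section Algorithm.
Variables (R : realType) (U : finType).

Definition double_step (x : U -> nat -> R) (t : nat) : U -> nat -> R :=
  fun e s => if s == t.*2 then x e s + x e t else x e s.

(* foldl runs the updates for t = 1, ..., #|U|./2 in this order, each one on
   the result of the previous ones. *)
Definition build_x (Q : R) (xstar : U -> nat -> R) : U -> nat -> R :=
  foldl double_step (fun e t => Q * xstar e t) (iota 1 #|U|./2).

(* The first t in [n] with \sum_(1 <= t' < t.+1) x e t' >= a; it is #|U|.+1
   if there is none. *)
Definition first_time (x : U -> nat -> R) (e : U) (a : R) : nat :=
  (find (fun t => a <= \sum_(1 <= t' < t.+1) x e t') (iota 1 #|U|)).+1.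

Definition alpha_pdf (a : R) : R := if 0 < a < 1 then 2 * a else 0.

(* s is a possible output for the drawn values a and ae: any tie-breaking is
   allowed. *)
Definition possible_output (z : R) (xstar : U -> nat -> R) (a : R)
    (ae : U -> R) (s : #|U|.-tuple U) : Prop :=
  let x := build_x (z / a) xstar in
  is_ordering s /\ sorted leq [seq first_time x e (ae e) | e <- s].

End Algorithm.

Definition mutually_independent (d : measure_display) (T : measurableType d)
    (R : realType) (P : probability T R) (I : finType)
    (X : I -> {RV P >-> R}) : Prop :=
  forall (J : {set I}) (B : I -> set R),
    (forall i, i \in J -> measurable (B i)) ->
    P (\bigcap_(i in [set` J]) (X i @^-1` B i)) =
    (\prod_(i in J) P (X i @^-1` B i))%E.

(* The randomness of the algorithm on an arbitrary probability space: the
   family indexed by option U consists of alpha (at None) and of the alpha_e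
   (at Some e). *)
Record algorithm_randomness (d : measure_display) (T : measurableType d)
    (R : realType) (P : probability T R) (U : finType)
    (alpha : {RV P >-> R}) (alpha_ : U -> {RV P >-> R}) : Prop := {
  alpha_law : forall B : set R, measurable B ->
    distribution P alpha B =
    (\int[lebesgue_measure]_(a in B) (alpha_pdf a)%:E)%E;
  alpha_uniform : forall (e : U) (B : set R), measurable B ->
    distribution P (alpha_ e) B = uniform_prob (@ltr01 R) B;
  alpha_indep :
    mutually_independent (fun i : option U => oapp alpha_ alpha i)
}.

(* sigma w is the output ordering in the outcome w; being a measurable
   function of w, it may break ties with the help of extra randomness. *)
Definition algorithm_output (d : measure_display) (T : measurableType d)
    (R : realType) (P : probability T R) (U : finType) (z : R)
    (xstar : U -> nat -> R) (alpha : {RV P >-> R})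
    (alpha_ : U -> {RV P >-> R}) (sigma : T -> #|U|.-tuple U) : Prop :=
  (forall s, measurable (sigma @^-1` [set s])) /\
  (forall w, possible_output z xstar (alpha w) (fun e => alpha_ e w) (sigma w)).

(* Main.v *)
Require Import Defs.
From mathcomp Require Import measurable_realfun zify ring lra.

Set Implicit Arguments.
Unset Strict Implicit.
Unset Printing Implicit Defensive.

Import Order.TTheory GRing.Theory Num.Theory.

Local Open Scope ring_scope.

(* The bound is proved with z = 3 and rho = 25.  For a set S let t0 be its
   alpha-point, so that the LP solution scaled by 1 / alpha knapsack-covers S by
   time t0.  Doubling makes every element receive at least (i + 1) times its
   scaled mass by time 2^i t0, while all elements together receive at most
   2 Q 2^i t0.  Discarding the elements of S that are scheduled with certainty,
   the exponential-moment bound with parameter 1/m, m = 3 (i + 1), shows that S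
   is not covered by time 2^i t0 with probability at most 2^(1 - m); this failure
   is negatively correlated with each event "e is scheduled by time 2^(i+1) t0".
   Hence E[C_S | alpha] <= 2 (3 / alpha) t0 (1 + sum_i 2^(i+1) 2^(1 - 3 (i+1)))
   = (10 / alpha) t0, and integrating against 2 alpha turns t0 / alpha into twice
   the LP cost of S.  Instead of conditioning on alpha, we cut (0, 1] into M
   intervals of equal length and bound everything by monotonicity on each of
   them; the first four intervals contribute O(1 / M^2), and on the others
   replacing alpha by an endpoint loses a factor of at most 5/4. *)

(** * The doubled solution: recursion, growth of mass, first times *)

Section BuildX.
Variables (R : realType) (U : finType).
Implicit Types (x : U -> nat -> R) (e : U).

(** Step [t] changes only the entry at [2 * t], so in increasing order entry [t] already has its
    final value when it is added; the result satisfies a recursion in itself. *)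
Lemma double_steps_rec x h e t :
  let b := foldl (@double_step R U) x (iota 1 h) in
  b e t = x e t + (if ~~ odd t && (0 < t./2 <= h)%N then b e t./2 else 0).
Proof.
elim: h t => [|h IH] t.
  by rewrite /=; case: ifP; rewrite ?addr0 // => /andP[_]; lia.
have -> : iota 1 h.+1 = rcons (iota 1 h) h.+1 by rewrite -[X in iota _ X]addn1 iotaD cats1.
move: IH; rewrite foldl_rcons /=.
set b := foldl _ _ _ => IH.
rewrite /double_step; have [->|ne] := eqVneq t h.+1.*2.
  rewrite odd_double doubleK ltnS leqnn /= IH odd_double doubleK ltnn andbF /=.
  by rewrite addr0 ifF //; lia.
rewrite IH; congr (_ + _).
case: (boolP (odd t)) => ot //=.
have -> : (0 < t./2 <= h.+1)%N = (0 < t./2 <= h)%N.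
  by move: ne ot; lia.
by case: ifP => // ?; rewrite ifF //; lia.
Qed.

Definition cumul x e (T : nat) : R := \sum_(1 <= t < T.+1) x e t.

Lemma cumul0 x e : cumul x e 0 = 0.
Proof. by rewrite /cumul big_geq. Qed.

Lemma cumulS x e T : cumul x e T.+1 = cumul x e T + x e T.+1.
Proof. by rewrite /cumul big_nat_recr. Qed.

(** Up to time [T] the added terms are the final values at times [1, ..., T./2], each arriving at
    the doubled time. The assumption on [T] ensures that all these updates are executed. *)
Lemma cumul_build_x (Q : R) x e T : (T <= #|U|)%N ->
  cumul (build_x Q x) e T = Q * cumul x e T + cumul (build_x Q x) e T./2.
Proof.
elim: T => [|T IH] leT; first by rewrite !cumul0 mulr0 addr0.
rewrite 2!cumulS mulrDr IH; last exact: ltnW.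
have -> : build_x Q x e T.+1 = Q * x e T.+1 +
    (if odd T then build_x Q x e T.+1./2 else 0).
  rewrite /build_x double_steps_rec -/(build_x Q x); congr (_ + _).
  rewrite oddS negbK; case: (boolP (odd T)) => [oT|_]; last by [].
  by rewrite andTb ifT //; lia.
case: (boolP (odd T)) => oT.
  have -> : T.+1./2 = (T./2).+1 by lia.
  by rewrite cumulS; ring.
have -> : T.+1./2 = T./2 by lia.
by ring.
Qed.

(** Separates the random factor [Q = z / alpha] from the fixed solution, so that it can later be
    bounded by an endpoint of the interval containing [alpha]. *)
Lemma cumul_build_xZ (Q : R) x e T : (T <= #|U|)%N ->
  cumul (build_x Q x) e T = Q * cumul (build_x 1 x) e T.
Proof.
elim/ltn_ind: T => -[_|T IH] leT; first by rewrite !cumul0 mulr0.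
rewrite cumul_build_x // IH; [|lia..].
by rewrite [in RHS]cumul_build_x //; ring.
Qed.

Lemma cumul_nondec x e s t : (forall u, (1 <= u <= #|U|)%N -> 0 <= x e u) ->
  (s <= t <= #|U|)%N -> cumul x e s <= cumul x e t.
Proof.
move=> x_ge0; case/andP; elim: t => [|t IH]; first by rewrite leqn0 => /eqP->.
rewrite leq_eqVlt => /orP[/eqP-> //|st] lt.
rewrite cumulS -[leLHS]addr0 lerD ?IH ?x_ge0 //; lia.
Qed.

Lemma cumul_ge0 x e t : (forall u, (1 <= u <= #|U|)%N -> 0 <= x e u) ->
  (t <= #|U|)%N -> 0 <= cumul x e t.
Proof. by move=> ? ?; rewrite -(cumul0 x e) cumul_nondec. Qed.

Section Feasible.
Variable x : U -> nat -> R.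
Hypothesis x_ge0 : forall e t, (1 <= t <= #|U|)%N -> 0 <= x e t.

Lemma build_x_ge0 (Q : R) e t : 0 <= Q -> (1 <= t <= #|U|)%N ->
  0 <= build_x Q x e t.
Proof.
move=> Q0; elim/ltn_ind: t => t IH tU.
rewrite /build_x double_steps_rec -/(build_x Q x) addr_ge0 //.
  by rewrite mulr_ge0 ?x_ge0.
by case: ifP => // ?; rewrite IH //; lia.
Qed.

Lemma cumul_build_x_ge (Q : R) e t : 0 <= Q -> (t <= #|U|)%N ->
  Q * cumul x e t <= cumul (build_x Q x) e t.
Proof.
move=> Q0 tU; rewrite [leRHS]cumul_build_x // lerDl.
by apply: cumul_ge0 => [u uU|]; [exact: build_x_ge0 | lia].
Qed.

(** Unfolding the recursion along [2 ^ i * t, ..., 2 * t, t] yields [i.+1] terms, each at least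
    [Q * cumul x e t]. *)
Lemma cumul_build_x_doubling (Q : R) e t i : 0 <= Q -> (2 ^ i * t <= #|U|)%N ->
  i.+1%:R * (Q * cumul x e t) <= cumul (build_x Q x) e (2 ^ i * t).
Proof.
move=> Q0; elim: i => [|i IH] leU.
  by rewrite expn0 mul1n mul1r cumul_build_x_ge //; lia.
have half : (2 ^ i.+1 * t)./2 = (2 ^ i * t)%N.
  by rewrite expnS -mulnA mul2n doubleK.
rewrite cumul_build_x // half -[i.+2%:R]natr1 mulrDl mul1r addrC.
apply: lerD; last by apply: IH; move: leU; rewrite expnS; lia.
rewrite ler_wpM2l // cumul_nondec => // [u /x_ge0//|].
by rewrite leU andbT leq_pmull // expn_gt0.
Qed.

Hypothesis x_time : forall t, (1 <= t <= #|U|)%N -> \sum_(e : U) x e t = 1.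

Lemma sum_cumul T : (T <= #|U|)%N -> \sum_e cumul x e T = T%:R.
Proof.
move=> TU; rewrite /cumul exchange_big /= big_nat.
rewrite (eq_bigr (fun=> 1)) => [|t tT]; last by rewrite x_time //; lia.
by rewrite -big_nat big_const_nat subn1 /= iter_addr addr0.
Qed.

(** By the recursion the total mass is at most the geometric sum [Q * (T + T / 2 + T / 4 + ...)]. *)
Lemma sum_cumul_build_x (Q : R) T : 0 <= Q -> (T <= #|U|)%N ->
  \sum_e cumul (build_x Q x) e T <= 2 * Q * T%:R.
Proof.
move=> Q0; elim/ltn_ind: T => -[_|T IH] leT.
  by rewrite mulr0 big1 // => e _; rewrite cumul0.
under eq_bigr do rewrite cumul_build_x //.
rewrite big_split /= -mulr_sumr sum_cumul //.
apply: (@le_trans _ _ (Q * T.+1%:R + 2 * Q * (T.+1)./2%:R)).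
  by rewrite lerD2l IH //; lia.
have : 2 * ((T.+1)./2)%:R <= T.+1%:R :> R.
  by rewrite -natrM ler_nat mul2n; lia.
move=> /(ler_wpM2l Q0); nra.
Qed.
End Feasible.

Lemma first_time_le x e (a : R) t : (1 <= t <= #|U|)%N ->
  a <= cumul x e t -> (first_time x e a <= t)%N.
Proof.
move=> tU at_; rewrite /first_time.
set p := (p in find p _).
rewrite leqNgt ltnS; apply/negP => lt.
have := @before_find _ 0%N p (iota 1 #|U|) t.-1.
rewrite nth_iota; last by lia.
have -> : (1 + t.-1)%N = t by lia.
rewrite /p -/(cumul x e t) at_ => H.
have /H : (t.-1 < find p (iota 1 #|U|))%N by move: lt; rewrite /p; lia.
by [].
Qed.

Lemma le_cumul_first_time x e (a : R) : (first_time x e a <= #|U|)%N ->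
  a <= cumul x e (first_time x e a).
Proof.
rewrite /first_time; set p := (p in find p _) => lt.
have hp : has p (iota 1 #|U|) by rewrite has_find size_iota.
have := nth_find 0%N hp; rewrite nth_iota ?add1n //.
Qed.

End BuildX.

(** * Positions and cover times in an ordering *)

Section CoverTime.
Variables (U : finType) (K : {set U} -> nat) (s : #|U|.-tuple U).
Hypothesis us : is_ordering s.
Variable S : {set U}.
Hypothesis KS : (1 <= K S <= #|S|)%N.

Lemma mem_ordering e : e \in s.
Proof.
have : s =i enum U.
  by apply: (uniq_min_size us _ _).2 => [x|]; rewrite ?mem_enum // !size_tuple.
by move->; rewrite mem_enum.
Qed.

Lemma index_ordering e : (index e s < #|U|)%N.
Proof. by have := mem_ordering e; rewrite -index_mem size_tuple. Qed.

Lemma count_ordering (p : pred U) : count p s = #|p|.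
Proof.
rewrite cardE /enum_mem -enumT size_filter; apply/permP.
by apply: uniq_perm => // [|e]; rewrite ?enum_uniq // mem_ordering mem_enum.
Qed.

Lemma size_filter_ordering : size [seq e <- s | e \in S] = #|S|.
Proof. by rewrite size_filter count_ordering. Qed.

(* Along a sorted sequence the elements of key at most [T] form a prefix, so
   the [K S]-th element of [S] lies in that prefix. *)
Lemma cover_time_le (f : U -> nat) T : sorted leq [seq f e | e <- s] ->
  (K S <= #|[set e in S | (f e <= T)%N]|)%N ->
  (cover_time K s S <= #|[set e | (f e <= T)%N]|)%N.
Proof.
rewrite sorted_map => srt KT.
pose p := [pred e | (f e <= T)%N].
have [s1 [s2 [ss a1 a2]]] : exists s1 s2,
    [/\ s = s1 ++ s2 :> seq U, all p s1 & all (predC p) s2].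
  elim: (tval s) srt => [|e t IH] /= srt; first by exists [::], [::].
  case: (leqP (f e) T) => pe.
    have [s1 [s2 [-> a1 a2]]] := IH (path_sorted srt).
    by exists (e :: s1), s2; rewrite /= pe.
  exists [::], (e :: t); split => //=; rewrite -ltnNge pe /=.
  have tr : transitive (relpre f leq) by move=> ? ? ?; apply: leq_trans.
  have /= := order_path_min tr srt.
  apply: sub_all => e' /=; rewrite -ltnNge; exact: leq_trans.
have cs1 : size s1 = #|[set e | (f e <= T)%N]|.
  rewrite cardsE -count_ordering ss count_cat.
  move: a1; rewrite all_count => /eqP ->.
  by move: a2; rewrite all_predC has_count -leqNgt leqn0 => /eqP ->; rewrite addn0.
have cS1 : (K S <= size [seq e <- s1 | e \in S])%N.
  apply: leq_trans KT _; rewrite cardsE -count_ordering ss count_cat.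
  rewrite size_filter [X in (_ + X)%N](_ : _ = 0)%N ?addn0.
    by apply: sub_count => e /= /andP[].
  apply/eqP; rewrite -leqn0 leqNgt -has_count; apply/hasPn => e /(allP a2) /=.
  by move=> /negPf ->; rewrite andbF.
have ltK : ((K S).-1 < size [seq e <- s1 | e \in S])%N by case/andP: KS; lia.
have e0 : U by case: (s1) ltK => [|e ?] //=.
rewrite /cover_time (nth_map e0); last first.
  by rewrite ss filter_cat size_cat; lia.
rewrite -cs1 ss filter_cat nth_cat ltK index_cat.
set e := nth _ _ _; have : e \in [seq e <- s1 | e \in S] by apply: mem_nth.
by rewrite mem_filter => /andP[_ es1]; rewrite es1 index_mem.
Qed.

Lemma cover_time_le_card : (cover_time K s S <= #|U|)%N.
Proof.
have ltK : ((K S).-1 < size [seq e <- s | e \in S])%N.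
  by rewrite size_filter_ordering; lia.
have e0 : U by case: (tval s) ltK => [|e ?] //=.
by rewrite /cover_time (nth_map e0) // index_ordering.
Qed.

(** In the order [s], the first [K S] elements of [S] are distinct, and none of them comes after the
    one that defines the cover time. *)
Lemma card_before_cover_time t : (cover_time K s S < t)%N ->
  (K S <= #|[set e in S | ((index e s).+1 < t)%N]|)%N.
Proof.
have ltK : ((K S).-1 < size [seq e <- s | e \in S])%N.
  by rewrite size_filter_ordering; lia.
have e0 : U by case: (tval s) ltK => [|e ?] //=.
rewrite /cover_time (nth_map e0) // => lt_t.
pose l := [seq e <- s | e \in S].
have ul : uniq l by rewrite filter_uniq.
have srt : sorted (relpre (index^~ s) ltn) l.
  apply: (@subseq_sorted _ _ _ _ s); [by move=> ? ? ?; apply: ltn_trans|exact: filter_subseq|].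
  apply/(sortedP e0) => i lti /=; rewrite !index_uniq //; exact: ltnW.
rewrite (_ : K S = size (take (K S) l)); last first.
  by rewrite size_takel // size_filter_ordering; case/andP: KS.
rewrite cardE; apply: uniq_leq_size => [|e]; first exact: take_uniq.
move=> et; have el := mem_take et.
rewrite mem_enum inE; move: (el); rewrite mem_filter => /andP[-> _] /=.
apply: leq_ltn_trans lt_t; rewrite ltnS.
rewrite -[e](nth_index e0 el).
have lti : (index e l <= (K S).-1)%N.
  move: et; rewrite -index_mem => et; rewrite -ltnS prednK; last by lia.
  rewrite -[l](cat_take_drop (K S)) index_cat -index_mem et.
  by apply: leq_trans et _; rewrite size_take_min geq_minl.
move: lti; rewrite leq_eqVlt => /orP[/eqP -> //|lti]; apply: ltnW.
have tr : transitive (relpre (index^~ s) ltn) by move=> ? ? ?; apply: ltn_trans.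
by have := sorted_ltn_nth tr e0 srt; apply; rewrite ?inE ?index_mem.
Qed.
End CoverTime.

(** * The LP as a relaxation of the ordering problem *)

Section Relaxation.
Variables (R : realType) (U : finType) (SS : {set {set U}}) (K : {set U} -> nat).
Hypothesis inst : gmssc_instance SS K.

Definition ordering_x (s : #|U|.-tuple U) (e : U) (t : nat) : R :=
  ((index e s).+1 == t)%:R.
(** The strict inequality matches the sum over [t' < t] in the covering constraint and makes each
    set contribute exactly its cover time to the objective. *)
Definition ordering_y (s : #|U|.-tuple U) (S : {set U}) (t : nat) : R :=
  (cover_time K s S < t)%N%:R.

Lemma sum_ordering_x s e t : 
  \sum_(1 <= t' < t) ordering_x s e t' = ((index e s).+1 < t)%N%:R.
Proof.
case: ltnP => lt.
  rewrite (bigD1_seq (index e s).+1) ?iota_uniq ?mem_index_iota //=.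
  rewrite /ordering_x eqxx big1 ?addr0 // => i /negPf; rewrite eq_sym => ->.
  by [].
rewrite big_nat big1 // => i ii; rewrite /ordering_x; case: eqP => //; lia.
Qed.

Lemma ordering_feasible s : is_ordering s ->
  lp_feasible SS K (ordering_x s) (ordering_y s).
Proof.
move=> us; split=> [t tU|e|S A t SSS AS tU|e t _|S t _ _].
- have ltt : (t.-1 < size s)%N by rewrite size_tuple; lia.
  have e0 : U by case: (tval s) ltt => [|e ?] //=.
  rewrite (bigD1 (nth e0 s t.-1)) //= /ordering_x index_uniq // prednK; last by lia.
  rewrite eqxx big1 ?addr0 // => e ne; case: eqP => // it.
  by move: ne; rewrite -it /= nth_index ?eqxx ?mem_ordering.
- by rewrite sum_ordering_x ltnS index_ordering.
- under eq_bigr do rewrite sum_ordering_x.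
  rewrite /ordering_y; case: ltnP => lt; rewrite ?mulr1 ?mulr0; last first.
    by apply: sumr_ge0.
  have := card_before_cover_time us (inst SSS) lt.
  set B := [set _ in _ | _] => KB.
  have -> : \sum_(e in S :\: A) ((index e s).+1 < t)%N%:R = #|B :\: A|%:R :> R.
    rewrite -sum1_card natr_sum big_mkcond [RHS]big_mkcond.
    apply: eq_bigr => e _; rewrite !inE.
    by case: (e \in A); case: (e \in S); case: ltnP.
  (* With [B] the elements of [S] placed before [t], [K S <= #|B| <= #|B :\: A| + #|A|]. *)
  rewrite lerBlDr -natrD ler_nat (leq_trans KB) // -(cardsID A B) addnC.
  by rewrite leq_add2l subset_leq_card // subsetIr.
- by rewrite /ordering_x; case: eqP; rewrite ?ler01 ?lexx.
- by rewrite /ordering_y; case: ltnP; rewrite ?ler01 ?lexx.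
Qed.

Lemma lp_value_ordering s : is_ordering s ->
  lp_value SS (ordering_y s) = (cost SS K s)%:R.
Proof.
move=> us; rewrite /lp_value /cost exchange_big natr_sum /=.
apply: eq_bigr => S SSS.
have := cover_time_le_card us (inst SSS).
rewrite /ordering_y; set c := cover_time _ _ _ => cU.
rewrite (big_cat_nat _ (n := c.+1)) //=.
rewrite [X in _ + X]big_nat [X in _ + X]big1 ?addr0; last first.
  by move=> t /andP[-> _]; rewrite subrr.
rewrite big_nat (eq_bigr (fun=> 1)); last first.
  by move=> t /andP[_ tc]; rewrite ltnNge -ltnS tc subr0.
by rewrite -big_nat big_const_nat subn1 /= iter_addr addr0.
Qed.

Lemma lp_value_le_OPT x y : lp_optimal SS K x y ->
  lp_value SS y <= (OPT SS K)%:R :> R.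
Proof.
case=> _ opt; have [[s us <-] _] := OPTP SS K.
by rewrite -lp_value_ordering //; apply: opt; apply: ordering_feasible.
Qed.
End Relaxation.

(** * Alpha-points of a set *)

Section AlphaPoint.
Variables (R : realType) (U : finType) (SS : {set {set U}}) (K : {set U} -> nat).
Variables (x : U -> nat -> R) (y : {set U} -> nat -> R).
Hypotheses (inst : gmssc_instance SS K) (feas : lp_feasible SS K x y).
Variable S : {set U}.
Hypothesis SSS : S \in SS.

Let x_ge0 e t : (1 <= t <= #|U|)%N -> 0 <= x e t.
Proof. by move=> /(lp_x_bounds feas e)/andP[]. Qed.

(* When [y S] is nondecreasing, this is the last time [t] with [y S t < a]. *)
Definition alpha_point (a : R) : nat := (\sum_(1 <= t < #|U|.+1) (y S t < a)%R)%N.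

Lemma alpha_point_le a : (alpha_point a <= #|U|)%N.
Proof.
rewrite /alpha_point -[leqRHS]muln1 -[X in (X * _)%N](subn1 #|U|.+1).
by rewrite -sum_nat_const_nat; apply: leq_sum => t _; exact: leq_b1.
Qed.

(** At time 1 the covering constraint for empty [A] has an empty sum on the right, and [K S >= 1],
    so [y S 1 <= 0 < a]. *)
Lemma alpha_point_gt0 a : 0 < a -> (0 < alpha_point a)%N.
Proof.
move=> a0; have /andP[K1 KS] := inst SSS.
have U1 : (1 <= #|U|)%N by rewrite (leq_trans K1) // (leq_trans KS) ?max_card.
have := @lp_cover _ _ _ _ _ _ feas S finset.set0 1%N SSS (finset.sub0set S).
rewrite cards0 subr0 U1 => /(_ isT); rewrite big1 => [|e _]; last by rewrite big_geq.
rewrite pmulr_rle0 ?ltr0n // => y0.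
by rewrite /alpha_point big_ltn // (le_lt_trans y0 a0).
Qed.

(** Pigeonhole: if [y S t < a] held at all of the first [(alpha_point a).+1] times, the count would
    exceed [alpha_point a]. *)
Lemma exists_alpha_point a : (alpha_point a < #|U|)%N ->
  exists2 t, (1 <= t <= (alpha_point a).+1)%N & a <= y S t.
Proof.
move=> lt.
have [/hasP[t]|/hasPn H] := boolP (has (fun t => a <= y S t) (iota 1 (alpha_point a).+1)).
  by rewrite mem_iota add1n ltnS => tt ayt; exists t.
exfalso; have : ((alpha_point a).+1 <= alpha_point a)%N; last by rewrite ltnn.
rewrite {2}/alpha_point (@big_cat_nat _ _ _ (alpha_point a).+2) //=.
apply: leq_trans (leq_addr _ _).
rewrite big_nat (eq_bigr (fun=> 1%N)); last first.
  by move=> t tt; rewrite ltNge H // mem_iota; lia.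
by rewrite -big_nat sum_nat_const_nat muln1 subn1.
Qed.

(** If the alpha-point is [#|U|], every element has its full mass 1 and [K S <= #|S|] suffices.
    Otherwise the covering constraint at some [t] with [a <= y S t] applies, and it involves only
    times up to the alpha-point. *)
Lemma alpha_point_cover (A : {set U}) a : 0 < a -> a <= 1 -> A \subset S ->
  ((K S)%:R - #|A|%:R) * a <= \sum_(e in S :\: A) cumul x e (alpha_point a).
Proof.
move=> a0 a1 AS.
have sum0 : 0 <= \sum_(e in S :\: A) cumul x e (alpha_point a).
  by apply: sumr_ge0 => e _; apply: cumul_ge0 => [t|]; [exact: x_ge0|exact: alpha_point_le].
have [KA|/ltW KA] := leP (K S)%:R (#|A|%:R : R).
  by apply: le_trans sum0; rewrite mulr_le0_ge0 ?subr_le0 // ltW.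
have := alpha_point_le a; rewrite leq_eqVlt => /orP[/eqP ->|lt].
  rewrite (eq_bigr (fun=> 1)); last by move=> e _; exact: (lp_elem feas e).
  rewrite sumr_const cardsD; move/finset.setIidPr : (AS) => ->.
  rewrite natrB ?subset_leq_card //.
  apply: (@le_trans _ _ ((K S)%:R - #|A|%:R)); first by rewrite ler_piMr // subr_ge0.
  by rewrite lerB // ler_nat; case/andP: (inst SSS).
have [t tt ayt] := exists_alpha_point lt.
have tU : (1 <= t <= #|U|)%N by lia.
apply: (@le_trans _ _ (((K S)%:R - #|A|%:R) * y S t)).
  by rewrite ler_wpM2l // subr_ge0.
apply: (le_trans (lp_cover feas SSS AS tU)).
apply: ler_sum => e _.
have -> : \sum_(1 <= t' < t) x e t' = cumul x e t.-1 by rewrite /cumul prednK //; lia.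
apply: cumul_nondec => [u|]; first exact: x_ge0.
rewrite alpha_point_le; lia.
Qed.

(** A Riemann sum for the integral of the alpha-point over [(0, 1]]: for each [t], exactly [M - f]
    sample points exceed [y S t], where [f] is the integer part of [M * y S t]. The term [#|U|]
    collects the rounding errors, at most one per [t]. *)
Lemma sum_alpha_point (M : nat) : (0 < M)%N ->
  (\sum_(0 <= j < M) alpha_point (j.+1%:R / M%:R))%:R
  <= M%:R * (\sum_(1 <= t < #|U|.+1) (1 - y S t)) + #|U|%:R.
Proof.
move=> M0; rewrite /alpha_point exchange_big natr_sum /= mulr_sumr.
have -> : #|U|%:R = \sum_(1 <= t < #|U|.+1) 1 :> R.
  by rewrite big_const_nat subn1 /= iter_addr addr0.
rewrite -big_split /=; apply: ler_sum_nat => t tU.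
have /andP[y0 y1] := lp_y_bounds feas SSS tU.
have M0' : 0 < M%:R :> R by rewrite ltr0n.
have fl0 : 0 <= M%:R * y S t by rewrite mulr_ge0.
set f := Num.trunc (M%:R * y S t).
have /andP[fl fu] := Num.Theory.trunc_itv fl0.
rewrite -/f in fl fu.
have fM : (f <= M)%N.
  by rewrite -(ler_nat R) (le_trans fl) // ler_piMr.
have -> : (\sum_(0 <= j < M) (y S t < j.+1%:R / M%:R)%R = M - f)%N.
  rewrite (@big_cat_nat _ _ _ f) //= [X in (X + _)%N]big_nat big1 ?add0n; last first.
    move=> j /andP[_ jf]; apply/eqP; rewrite eqb0 -leNgt ler_pdivrMr // mulrC.
    by apply: le_trans fl; rewrite ler_nat.
  rewrite big_nat (eq_bigr (fun=> 1%N)); last first.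
    move=> j /andP[fj _]; rewrite ltr_pdivlMr // mulrC (lt_le_trans fu) // ler_nat.
    by rewrite ltnS.
  by rewrite -big_nat sum_nat_const_nat muln1.
rewrite natrB //; move: fu; rewrite -[f.+1%:R]natr1; nra.
Qed.

End AlphaPoint.

(** * Exponential-moment lower tail bound *)

(** All but one of the [k] exponential factors pair with an [m], and [m * expR (1 - m) <= 1]; the
    remaining factor is at most [2 ^ (1 - m)] since [e >= 2]. *)
Lemma expR_lower_tail (R : realType) (m k : nat) : (0 < m)%N -> (0 < k)%N ->
  m%:R ^+ k.-1 * expR (- m.-1%:R) ^+ k <= 2^-1 ^+ m.-1 :> R.
Proof.
case: m k => // m [//|k] _ _ /=; rewrite exprS mulrCA -exprMn.
have e2 : expR (- m%:R) <= 2^-1 ^+ m :> R.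
  rewrite expRN exprVn lef_pV2 ?posrE ?expR_gt0 ?exprn_gt0 //.
  rewrite -[m%:R]mulr1 expRM_natl lerXn2r ?nnegrE ?expR_ge0 //.
  by have := expR_ge1Dx (1 : R); lra.
apply: le_trans e2; rewrite ler_piMr ?expR_ge0 // exprn_ile1 ?mulr_ge0 ?expR_ge0 //.
rewrite expRN ler_pdivrMr ?expR_gt0 // mul1r -natr1 addrC; exact: expR_ge1Dx.
Qed.

(** The factor [q e / m + (1 - q e)] is the expectation of [m ^ (- X)] for a Bernoulli variable [X]
    of mean [q e], so the left side is Markov's bound on having fewer than [k] successes. Each
    factor is at most [expR (- (1 - 1 / m) * q e)], and a total mean of at least [m * k] gives the
    exponent [- (m - 1) * k]. *)
Lemma prod_lower_tail (R : realType) (U : finType) (A : {set U}) (q : U -> R)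
    (m k : nat) : (0 < m)%N -> (0 < k)%N ->
  (forall e, e \in A -> 0 <= q e <= 1) -> (m * k)%:R <= \sum_(e in A) q e ->
  m%:R ^+ k.-1 * \prod_(e in A) (q e / m%:R + (1 - q e)) <= 2^-1 ^+ m.-1.
Proof.
move=> m0 k0 q01 mk; apply: le_trans (expR_lower_tail R m0 k0).
have m0' : 0 < m%:R :> R by rewrite ltr0n.
have m1' : 0 <= 1 - m%:R^-1 :> R by rewrite subr_ge0 invf_le1 // ler1n.
rewrite ler_wpM2l ?exprn_ge0 //.
apply: (@le_trans _ _ (\prod_(e in A) expR (- (1 - m%:R^-1) * q e))).
  apply: ler_prod => e /q01/andP[q0 q1]; apply/andP; split.
    by rewrite addr_ge0 ?divr_ge0 ?subr_ge0.
  by apply: le_trans (expR_ge1Dx _); rewrite le_eqVlt; apply/orP; left; apply/eqP; ring.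
rewrite -expR_sum -mulr_sumr -expRM_natl ler_expR mulNr mulrN lerN2.
apply: le_trans (ler_wpM2l m1' mk).
have -> : m.-1%:R = m%:R - 1 :> R by rewrite -subn1 natrB.
rewrite natrM mulrBl mul1r mulKf ?gt_eqF //; lra.
Qed.

(** * Rounds: scheduling by time [2 ^ i * t0] *)

Section Rounds.
Variables (R : realType) (U : finType) (SS : {set {set U}}) (K : {set U} -> nat).
Variables (x : U -> nat -> R) (y : {set U} -> nat -> R).
Hypotheses (inst : gmssc_instance SS K) (feas : lp_feasible SS K x y).
Variable S : {set U}.
Hypothesis SSS : S \in SS.
Variables z lo hi : R.
Hypotheses (z1 : 1 <= z) (lo0 : 0 < lo) (hi0 : 0 < hi) (hi1 : hi <= 1).

Let x_ge0 e t : (1 <= t <= #|U|)%N -> 0 <= x e t.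
Proof. by move=> /(lp_x_bounds feas e)/andP[]. Qed.

Let t0 := alpha_point y S hi.
Let z0 : 0 < z. Proof. exact: lt_le_trans z1. Qed.
Let t0U : (t0 <= #|U|)%N. Proof. exact: alpha_point_le. Qed.

(* Write [t0 := alpha_point y S hi] and let [lo < alpha <= hi].  If [alpha_e] is
   at most [round_low i.+1 e] then [e] is scheduled by time [2 ^ i * t0]; if [e]
   is scheduled by time [2 ^ i * t0] then [alpha_e] is at most [round_high i e]. *)
Definition round_low (i : nat) (e : U) : R :=
  i%:R * (z / hi * cumul x e (alpha_point y S hi)).

Definition round_high (i : nat) (e : U) : R :=
  z / lo * cumul (build_x 1 x) e (minn (2 ^ i * alpha_point y S hi) #|U|).

(** Since every [alpha_e] is at most 1, for [i >= 1] these elements are certain to be scheduled by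
    time [2 ^ i.-1 * t0]. They serve as the set [A] of the covering constraint. *)
Definition saturated (i : nat) : {set U} := [set e in S | 1 <= round_low i e].

Lemma round_low_ge0 i e : 0 <= round_low i e.
Proof. by rewrite !mulr_ge0 ?invr_ge0 ?cumul_ge0 // ?ltW // => u; exact: x_ge0. Qed.

Lemma cumul_build_x1_ge0 e t : (t <= #|U|)%N -> 0 <= cumul (build_x 1 x) e t.
Proof. by move=> tU; apply: cumul_ge0 => // u uU; rewrite build_x_ge0. Qed.

Lemma round_high_ge0 i e : 0 <= round_high i e.
Proof. by rewrite !mulr_ge0 ?invr_ge0 ?cumul_build_x1_ge0 ?geq_minr // ltW. Qed.

Lemma sum_round_high i :
  \sum_e round_high i e <= 2 * (z / lo) * (2 ^+ i * t0%:R).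
Proof.
rewrite -mulr_sumr [2 * _]mulrC -[leRHS]mulrA ler_wpM2l //.
  by rewrite divr_ge0 // ltW.
have := sum_cumul_build_x (lp_time feas) ler01 (geq_minr (2 ^ i * t0) #|U|).
move=> /le_trans; apply.
rewrite mulr1 ler_wpM2l // -natrX -natrM ler_nat; exact: geq_minl.
Qed.

(** The factor [hi] in the covering bound at the alpha-point cancels the scaling [z / hi], leaving
    [i * z] times the residual demand. *)
Lemma sum_round_low i :
  i%:R * z * ((K S)%:R - #|saturated i|%:R)
    <= \sum_(e in S :\: saturated i) round_low i e.
Proof.
have AS : saturated i \subset S by apply/fintype.subsetP => e; rewrite inE => /andP[].
set d := _ - _; have -> : i%:R * z * d = i%:R * (z / hi * (d * hi)).
  by field; rewrite gt_eqF.
rewrite -!mulr_sumr ler_wpM2l // ler_wpM2l //; first by rewrite divr_ge0 // ltW.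
exact: (alpha_point_cover inst feas SSS hi0 hi1 AS).
Qed.

(** The witness is the first round [i] by whose time [2 ^ i * t0] at least [K S] elements of [S] are
    scheduled: its success bounds the cover time, and the failure of the preceding round gives the
    low count. *)
Lemma cover_time_round a (u : U -> R) (s : #|U|.-tuple U) :
  lo < a -> a <= hi -> (forall e, u e <= 1) -> is_ordering s ->
  sorted leq [seq first_time (build_x (z / a) x) e (u e) | e <- s] ->
  exists i, [/\ (i <= #|U|)%N,
    (cover_time K s S <= #|[set e | (u e <= round_high i e)%R]|)%N &
    i = 0%N \/ (#|[set e in S :\: saturated i | (u e <= round_low i e)%R]|
                  < K S - #|saturated i|)%N].
Proof.
move=> loa ahi u1 us; set f := fun e => first_time _ e (u e) => srt.
have a0 : 0 < a by exact: lt_trans loa.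
have za0 : 0 <= z / a by rewrite divr_ge0 // ltW.
have U0 : (0 < #|U|)%N.
  by have /andP[K1 KS] := inst SSS; rewrite (leq_trans K1) // (leq_trans KS) ?max_card.
have t0_gt0 : (0 < t0)%N by exact: (alpha_point_gt0 inst feas SSS hi0).
(* The total mass of [e] is at least [z / a >= 1 >= u e], so the default value [#|U|.+1] of
   [first_time] does not occur. *)
have fU e : (f e <= #|U|)%N.
  apply: first_time_le; first by rewrite U0 leqnn.
  apply: le_trans (cumul_build_x_ge x_ge0 _ za0 (leqnn _)).
  rewrite {1}/cumul (lp_elem feas) mulr1 (le_trans (u1 e)) // ler_pdivlMr // mul1r.
  exact: le_trans (le_trans ahi hi1) z1.
have f_le i e : u e <= round_low i.+1 e -> (f e <= 2 ^ i * t0)%N.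
  move=> uL; have [iU|/ltnW iU] := leqP (2 ^ i * t0) #|U|; last exact: leq_trans iU.
  apply: first_time_le; first by rewrite iU muln_gt0 expn_gt0 t0_gt0.
  apply: le_trans (cumul_build_x_doubling x_ge0 _ za0 iU).
  apply: (le_trans uL); rewrite ler_wpM2l // ler_wpM2r //.
    by apply: cumul_ge0 => // v; exact: x_ge0.
  by rewrite ler_pM2l // lef_pV2.
have f_ge i e : (f e <= 2 ^ i * t0)%N -> u e <= round_high i e.
  move=> fT; apply: le_trans (le_cumul_first_time (fU e)) _.
  apply: (@le_trans _ _ (cumul (build_x (z / a) x) e (minn (2 ^ i * t0) #|U|))).
    apply: cumul_nondec => [v vU|]; first exact: build_x_ge0.
    by rewrite geq_minr andbT leq_min fT fU.
  rewrite cumul_build_xZ ?geq_minr // ler_wpM2r //.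
    by rewrite cumul_build_x1_ge0 ?geq_minr.
  by rewrite ler_pM2l // lef_pV2 // ltW.
pose p i := (K S <= #|[set e in S | (f e <= 2 ^ i * t0)%N]|)%N.
(* At round [#|U|] the time bound exceeds [#|U|], so all of [S] is scheduled and a least round
   exists. *)
have pU : p #|U|.
  rewrite /p (_ : [set _ in _ | _] = S); first by case/andP: (inst SSS).
  apply/setP => e; rewrite inE (leq_trans (fU e)) ?andbT //.
  by rewrite (leq_trans (ltnW (ltn_expl #|U| (ltnSn 1)))) // leq_pmulr.
have /ex_minnP[i pi mini] : exists i, p i by exists #|U|.
exists i; split; first exact: mini.
- apply: leq_trans (cover_time_le us (inst SSS) srt pi) _.
  by apply/subset_leq_card/fintype.subsetP => e; rewrite !inE; exact: f_ge.
- case: i pi mini => [|i] pi mini; [by left|right].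
  (* By minimality fewer than [K S] elements of [S] are scheduled by time [2 ^ i * t0]; these
     include all saturated ones and all with [u e <= round_low i.+1 e]. *)
  have : ~~ p i by apply/negP => /mini; rewrite ltnn.
  rewrite -ltnNge ltn_subRL; apply: leq_ltn_trans.
  rewrite -cardsUI [X in (_ + X)%N]eq_card0 ?addn0; last first.
    by move=> e; rewrite !inE; case: (e \in S); case: (1 <= _).
  apply/subset_leq_card/fintype.subsetP => e; rewrite !inE => /orP[/andP[eS L1]|].
    by rewrite eS f_le // (le_trans (u1 e)).
  by move=> /andP[/andP[_ ->]] /f_le.
Qed.

End Rounds.

(** * Tools on unions, integrals and preimages *)

Local Open Scope classical_set_scope.

Lemma big_option (R : Type) (idx : R) (op : Monoid.com_law idx) (I : finType)
    (F : option I -> R) :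
  \big[op/idx]_(i : option I) F i = op (F None) (\big[op/idx]_(i : I) F (Some i)).
Proof.
rewrite (bigD1 None) //=; congr (op _ _).
rewrite (reindex_omap Some id) => [|[]//].
by apply: eq_bigl => i; rewrite eqxx.
Qed.

Lemma probability_bigsetU_le (d : measure_display) (T : measurableType d)
    (R : realType) (P : probability T R) (I : Type) (r : seq I)
    (p : pred I) (F : I -> set T) :
  (forall i, measurable (F i)) ->
  measurable (\big[setU/set0]_(i <- r | p i) F i) /\
  (P (\big[setU/set0]_(i <- r | p i) F i) <= \sum_(i <- r | p i) P (F i))%E.
Proof.
move=> mF.
apply: (big_ind2 (fun X y => measurable X /\ (P X <= y)%E)) => [|X a Y b [mX Xa] [mY Yb]|//].
  by rewrite measure0.
split; first exact: measurableU.
by rewrite (le_trans (measureU2 _ _ _)) // leeD.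
Qed.

Lemma integral_le_cst_measure (R : realType) (g : R -> R) (B D : set R) (C : R) :
  measurable B -> measurable D -> measurable_fun setT g ->
  (forall v, B v -> 0 <= g v) -> (forall v, B v -> ~ D v -> g v = 0) ->
  (forall v, B v -> D v -> g v <= C) -> 0 <= C ->
  (\int[lebesgue_measure]_(v in B) (g v)%:E <= C%:E * lebesgue_measure D)%E.
Proof.
move=> mB mD mg g0 gD gC C0.
have -> : (\int[lebesgue_measure]_(v in B) (g v)%:E =
           \int[lebesgue_measure]_(v in B `&` D) (g v)%:E)%E.
  rewrite [RHS]integral_mkcondr; apply: eq_integral => v /set_mem Bv.
  by rewrite patchE; case: ifPn => //; rewrite notin_setE => Dv; rewrite gD.
have mBD : measurable (B `&` D) by exact: measurableI.
apply: (@le_trans _ _ (\int[lebesgue_measure]_(v in B `&` D) (cst C%:E) v)%E).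
  apply: ge0_le_integral => //=.
  - by move=> v [/g0]; rewrite lee_fin.
  - by apply: measurableT_comp => //; exact: measurable_funS mg.
  - by move=> v [Bv Dv]; rewrite lee_fin gC.
rewrite integral_cst // lee_wpmul2l ?lee_fin // le_measure ?inE //.
Qed.

Lemma measurable_alpha_pdf (R : realType) : measurable_fun setT (@alpha_pdf R).
Proof.
rewrite /alpha_pdf; apply: measurable_fun_if => //=.
  by apply: measurable_and => //; exact: measurable_fun_ltr.
Qed.

Lemma measurable_RV_preimage (d : measure_display) (T : measurableType d)
    (R : realType) (P : probability T R) (X : {RV P >-> R}) (B : set R) :
  measurable B -> measurable (X @^-1` B).
Proof. by move=> mB; rewrite -[_ @^-1` _]setTI; exact: measurable_funPT. Qed.

(** * Laws of the random thresholds and the low-count event *)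

Section Randomness.
Variables (d : measure_display) (T : measurableType d) (R : realType).
Variables (P : probability T R) (U : finType).
Variables (alpha : {RV P >-> R}) (alpha_ : U -> {RV P >-> R}).
Hypothesis rand : algorithm_randomness alpha alpha_.

Lemma prob_alpha_le (B D : set R) (C : R) : measurable B -> measurable D ->
  (forall v, B v -> 0 < v < 1 -> D v /\ 2 * v <= C) -> 0 <= C ->
  (P (alpha @^-1` B) <= C%:E * lebesgue_measure D)%E.
Proof.
move=> mB mD BD C0; have := alpha_law rand mB; rewrite /distribution /pushforward => ->.
apply: integral_le_cst_measure => //; first exact: measurable_alpha_pdf.
- by move=> v _; rewrite /alpha_pdf; case: ifP => // /andP[v0 _]; rewrite mulr_ge0 // ltW.
- by move=> v /BD H nD; rewrite /alpha_pdf; case: ifP => // /H[].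
- by move=> v /BD H _; rewrite /alpha_pdf; case: ifP => // /H[].
Qed.

Lemma prob_alpha_e_le e (B D : set R) : measurable B -> measurable D ->
  (forall v, B v -> 0 <= v <= 1 -> D v) ->
  (P (alpha_ e @^-1` B) <= lebesgue_measure D)%E.
Proof.
move=> mB mD BD; rewrite -[leRHS]mul1e.
have := alpha_uniform rand e mB; rewrite /distribution /pushforward => ->.
apply: integral_le_cst_measure => //; first exact: measurable_uniform_pdf.
- by move=> v _; exact: uniform_pdf_ge0.
- by move=> v /BD H nD; rewrite /uniform_pdf; case: ifP => // /H.
- by move=> v /BD H _; rewrite /uniform_pdf; case: ifP => // _; rewrite subr0 invr1.
Qed.

Lemma prob_alpha_e_itv_le e (B : set R) (a b : R) : measurable B ->
  (forall v, B v -> 0 <= v <= 1 -> a <= v <= b) -> a <= b ->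
  (P (alpha_ e @^-1` B) <= (b - a)%:E)%E.
Proof.
move=> mB BD ab; apply: (@le_trans _ _ (lebesgue_measure `[a, b]%classic)).
  by apply: prob_alpha_e_le => // v /BD; rewrite /= in_itv.
rewrite lebesgue_measure_itv /= lte_fin; case: ltP => // _.
by rewrite lee_fin subr_ge0.
Qed.

Section LowCount.
Variables (B : set R) (e0 : U) (h : R) (A : {set U}) (q : U -> R).
Hypotheses (mB : measurable B) (h0 : 0 <= h).
Hypothesis q01 : forall e, e \in A -> 0 <= q e <= 1.

(** A condition on [alpha_ e] alone, so that joint events are products to which independence
    applies; [b] tells whether [alpha_ e <= q e] is to hold. *)
Definition count_cell (b : bool) (e : U) : set R :=
  (if e == e0 then `]-oo, h]%classic else setT) `&`
  (if e \in A then (if b then `]-oo, q e]%classic else `]q e, +oo[%classic)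
   else (if b then set0 else setT)).

(* [J] records which of the events [alpha_ e <= q e], [e \in A], occur;
   cylinders with [J] not included in [A] are empty. *)
Definition count_cylinder (J : {set U}) : set T :=
  \bigcap_(i in [set` [set: option U]%SET])
    ((oapp alpha_ alpha i : {RV P >-> R}) @^-1`
      (if i is Some e then count_cell (e \in J) e else B)).

(** Splitting by the exact set [J] of elements below their thresholds writes a counting event as a
    finite union of product events. *)
Definition low_count (k : nat) : set T :=
  \big[setU/set0]_(J : {set U} | (#|J| < k)%N) count_cylinder J.

Lemma measurable_count_cell b e : measurable (count_cell b e).
Proof.
by apply: measurableI; case: ifP => // _; case: b => //.
Qed.

Lemma measurable_count_cylinder J : measurable (count_cylinder J).
Proof.
apply: fin_bigcap_measurable; first exact: finite_finset.
by case=> [e|] _; apply: measurable_RV_preimage => //; exact: measurable_count_cell.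
Qed.

Lemma low_countP k w : B (alpha w) -> alpha_ e0 w <= h ->
  (#|[set e in A | (alpha_ e w <= q e)%R]%SET| < k)%N -> low_count k w.
Proof.
set J := [set e in A | _]%SET => Bw hw lt.
rewrite /low_count (bigD1 J) //=; left => -[e|] _ //=.
split; first by case: ifP => [/eqP->|//]; rewrite /= in_itv.
rewrite inE; case: ifP => eA; rewrite eA //=.
by case: ifPn => /=; rewrite in_itv /= ?andbT // -ltNge.
Qed.

Lemma measurable_low_count k : measurable (low_count k).
Proof. by apply: bigsetU_measurable => J _; exact: measurable_count_cylinder. Qed.

Let mass b e : R := fine (P (alpha_ e @^-1` count_cell b e)).

Lemma prob_count_cylinder J : P (count_cylinder J) =
  (P (alpha @^-1` B) * (\prod_e mass (e \in J) e)%:E)%E.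
Proof.
rewrite /count_cylinder (alpha_indep rand); last first.
  by case=> [e|] _ //; exact: measurable_count_cell.
rewrite [LHS](eq_bigl xpredT) => [|i]; last by rewrite finset.in_setT.
rewrite big_option /=; congr (_ * _)%E.
rewrite -prodEFin; apply: eq_bigr => e _.
by rewrite fineK ?fin_num_measure //; apply: measurable_RV_preimage; exact: measurable_count_cell.
Qed.

Let mass_ge0 b e : 0 <= mass b e.
Proof. by rewrite fine_ge0. Qed.

Let mass_le b e (a c : R) :
  (forall v, count_cell b e v -> 0 <= v <= 1 -> a <= v <= c) -> a <= c ->
  mass b e <= c - a.
Proof.
move=> H ac; rewrite -lee_fin fineK ?fin_num_measure //.
  by apply: prob_alpha_e_itv_le => //; exact: measurable_count_cell.
by apply: measurable_RV_preimage; exact: measurable_count_cell.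
Qed.

(* Conditioning on [alpha_ e0 <= h] can only make [alpha_ e0 <= q e0] more
   likely (Harris' inequality for one variable). *)
Lemma mass_mix m e : (0 < m)%N ->
  mass true e / m%:R + mass false e
  <= (if e == e0 then h else 1) *
     (if e \in A then q e / m%:R + (1 - q e) else 1).
Proof.
move=> m0; have m0' : 0 < m%:R :> R by rewrite ltr0n.
have mi0 : 0 < m%:R^-1 :> R by rewrite invr_gt0.
have mi1 : m%:R^-1 <= 1 :> R by rewrite invf_le1 // ler1n.
have := @mass_le true e; have := @mass_le false e; have := mass_ge0 true e.
rewrite /count_cell; case: (boolP (e \in A)) => eA; last first.
  move=> t0 Hf Ht; have /(_ 0 0) := Ht; rewrite subr0 => Ht0.
  have -> : mass true e = 0.
    by apply/eqP; rewrite eq_le t0 Ht0 // => v [].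
  rewrite mul0r add0r mulr1 -[leRHS]subr0; apply: Hf.
    move=> v [Hv _] /andP[-> v1] /=; move: Hv.
    by case: (e == e0); rewrite /= ?in_itv.
  by case: ifP.
have /andP[q0 q1] := q01 eA.
case: ifP => ee0 t0 Hf Ht.
  have [h1|h1] := leP 1 h.
    have {}Ht : mass true e <= q e - 0.
      by apply: Ht => // v [_] /=; rewrite in_itv /= => -> /andP[->].
    have {}Hf : mass false e <= 1 - q e.
      by apply: Hf => // v [_] /=; rewrite in_itv /= andbT => /ltW-> /andP[_ ->].
    apply: (@le_trans _ _ (1 * (q e / m%:R + (1 - q e)))); last first.
      by rewrite ler_wpM2r // addr_ge0 ?divr_ge0 ?subr_ge0.
    by rewrite mul1r lerD // ler_wpM2r ?invr_ge0 //; lra.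
  have [hq|qh] := leP h (q e).
    have {}Ht : mass true e <= h - 0.
      by apply: Ht => // v [] /=; rewrite !in_itv /= => -> _ /andP[->].
    have {}Hf : mass false e <= 0 - 0.
      apply: Hf => // v [] /=; rewrite !in_itv /= andbT => vh qv.
      by have := lt_le_trans (le_lt_trans hq qv) vh; rewrite ltxx.
    (* After inserting the bounds on the two masses, this product is exactly the right side minus
       the left side; the case [q e < h] uses its own such product. *)
    have mix := mulr_ge0 h0 (mulr_ge0 (_ : 0 <= 1 - q e) (_ : 0 <= 1 - m%:R^-1)).
    have := ler_wpM2r (ltW mi0) Ht; have := mix; rewrite !subr_ge0; nra.
  have {}Ht : mass true e <= q e - 0.
    by apply: Ht => // v [_] /=; rewrite in_itv /= => -> /andP[->].
  have {}Hf : mass false e <= h - q e.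
    apply: Hf; last exact: ltW.
    by move=> v [] /=; rewrite !in_itv /= andbT => -> /ltW ->.
  have mix := mulr_ge0 q0 (mulr_ge0 (_ : 0 <= 1 - h) (_ : 0 <= 1 - m%:R^-1)).
  have := ler_wpM2r (ltW mi0) Ht; have := mix; rewrite !subr_ge0; nra.
have {}Ht : mass true e <= q e - 0.
  by apply: Ht => // v [_] /=; rewrite in_itv /= => -> /andP[->].
have {}Hf : mass false e <= 1 - q e.
  by apply: Hf => // v [_] /=; rewrite in_itv /= andbT => /ltW-> /andP[_ ->].
by rewrite mul1r lerD // ler_wpM2r ?invr_ge0 //; lra.
Qed.

(** Markov's inequality in product form: [#|J| <= k.-1] pays for a weight [1 / m] per element of
    [J]; the sum is then extended to all [J] and factors over the elements, only [e0] contributing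
    [h]. *)
Lemma sum_mass_le m k : (0 < m)%N -> 
  \sum_(J : {set U} | (#|J| < k)%N) \prod_e mass (e \in J) e
  <= m%:R ^+ k.-1 * (h * \prod_(e in A) (q e / m%:R + (1 - q e))).
Proof.
move=> m0; have m0' : 0 < m%:R :> R by rewrite ltr0n.
pose w (J : {set U}) e := if e \in J then mass true e / m%:R else mass false e.
have w0 J e : 0 <= w J e by rewrite /w; case: ifP => // _; rewrite divr_ge0.
apply: (@le_trans _ _ (\sum_(J : {set U} | (#|J| < k)%N) m%:R ^+ k.-1 * \prod_e w J e)).
  apply: ler_sum => J Jk.
  have -> : \prod_e mass (e \in J) e = m%:R ^+ #|J| * \prod_e w J e.
    rewrite -prodr_const [X in _ = X * _]big_mkcond /= -big_split /=; apply: eq_bigr => e _.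
    by rewrite /w; case: ifP => _; rewrite ?mul1r // mulrCA divff ?mulr1 // gt_eqF.
  rewrite ler_wpM2r ?prodr_ge0 // ler_weXn2l ?ler1n //; lia.
rewrite -mulr_sumr ler_wpM2l ?exprn_ge0 //.
apply: (@le_trans _ _ (\sum_(J : {set U}) \prod_e w J e)).
  by rewrite big_mkcond; apply: ler_sum => J _; case: ifP => // _; rewrite prodr_ge0.
have -> : \sum_(J : {set U}) \prod_e w J e = \prod_e (mass true e / m%:R + mass false e).
  by rewrite bigA_distr /=; apply: eq_bigl => J.
apply: (@le_trans _ _ (\prod_e ((if e == e0 then h else 1) *
     (if e \in A then q e / m%:R + (1 - q e) else 1)))).
  by apply: ler_prod => e _; rewrite mass_mix // andbT addr_ge0 ?divr_ge0.
rewrite big_split /= -!big_mkcond /= big_pred1_eq //.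
Qed.

Lemma prob_low_count_le m k : (0 < m)%N ->
  (P (low_count k) <= P (alpha @^-1` B) *
     (m%:R ^+ k.-1 * (h * \prod_(e in A) (q e / m%:R + (1 - q e))))%:E)%E.
Proof.
move=> m0.
have [_ /le_trans] := probability_bigsetU_le P (index_enum _)
  (fun J : {set U} => (#|J| < k)%N) measurable_count_cylinder.
apply; rewrite [leLHS](eq_bigr _ (fun J _ => prob_count_cylinder J)).
rewrite -ge0_sume_distrr => [|J _]; last by rewrite lee_fin prodr_ge0.
by rewrite lee_wpmul2l // sumEFin lee_fin sum_mass_le.
Qed.

End LowCount.
End Randomness.

(** * Expectation bounds and the series over the rounds *)

Lemma expectation_le_events (d : measure_display) (T : measurableType d)
    (R : realType) (P : probability T R) (I : finType) (X : T -> R)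
    (c : I -> R) (E : I -> set T) :
  measurable_fun setT X -> (forall w, 0 <= X w) ->
  (forall i, 0 <= c i) -> (forall i, measurable (E i)) ->
  (forall w, X w <= \sum_i c i * \1_(E i) w) ->
  ('E_P[X] <= \sum_i (c i)%:E * P (E i))%E.
Proof.
move=> mX X0 c0 mE XE; rewrite unlock.
have mI i : measurable_fun setT (fun w => (\1_(E i) w)%:E : \bar R).
  by apply/measurable_EFinP; exact: measurable_indic.
apply: (@le_trans _ _ (\int[P]_w (\sum_i (c i)%:E * (\1_(E i) w)%:E))%E).
  apply: ge0_le_integral => //.
  - by move=> w _; rewrite lee_fin.
  - exact/measurable_EFinP.
  - by apply: emeasurable_sum => i _; apply: emeasurable_funM.
  - by move=> w _; under eq_bigr do rewrite -EFinM; rewrite sumEFin lee_fin.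
rewrite ge0_integral_sum //=; last 2 first.
- by move=> i; apply: emeasurable_funM.
- by move=> i w _; rewrite -EFinM lee_fin mulr_ge0.
rewrite le_eqVlt; apply/orP; left; apply/eqP; apply: eq_bigr => i _.
by rewrite ge0_integralZl_EFin // integral_indic // setIT.
Qed.

Lemma measurable_fun_of_finite (d : measure_display) (T : measurableType d)
    (R : realType) (V : finType) (s : T -> V) (g : V -> R) :
  (forall v, measurable (s @^-1` [set v])) -> measurable_fun setT (g \o s).
Proof.
move=> ms _ Y mY; rewrite setTI.
have -> : (g \o s) @^-1` Y = \bigcup_(v in [set v | Y (g v)]) (s @^-1` [set v]).
  by apply/seteqP; split=> [w Yw|w [v Yv /= sv]]; [exists (s w)|rewrite /= sv].
by apply: fin_bigcup_measurable => // v _; exact: ms.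
Qed.

(** For [i >= 1], the bound [2 ^ (1 - m)] with [m = 3 * i] on the probability that [S] is not
    covered by time [2 ^ i.-1 * t0]; round 0 needs no earlier failure. *)
Definition round_bound (R : realType) (i : nat) : R :=
  if i == 0%N then 1 else 2^-1 ^+ (3 * i).-1.

Lemma round_bound_ge0 (R : realType) i : 0 <= round_bound R i.
Proof. by rewrite /round_bound; case: ifP. Qed.

(** For [i >= 1] the term is [2 * 4 ^ (- i)], so the series is [1 + 2 / 3]. *)
Lemma sum_round_bound (R : realType) (n : nat) :
  \sum_(i < n.+1) round_bound R i * 2 ^+ i <= 5 / 3.
Proof.
suff -> : \sum_(i < n.+1) round_bound R i * 2 ^+ i = 5 / 3 - 2 / 3 * 4^-1 ^+ n.
  by rewrite gerBl mulr_ge0 ?exprn_ge0.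
elim: n => [|n IH]; first by rewrite big_ord1 /round_bound /= !expr0; lra.
rewrite big_ord_recr /= IH.
have -> : round_bound R n.+1 * 2 ^+ n.+1 = 2 * 4^-1 ^+ n.+1.
  rewrite /round_bound.
  have -> : ((3 * n.+1).-1 = n.+1 + n.+1 + n)%N by lia.
  have -> : 4^-1 = 2^-1 * 2^-1 :> R by lra.
  have h : 2^-1 ^+ n * 2 ^+ n.+1 = 2 :> R.
    by rewrite exprS mulrCA -exprMn mulVf ?expr1n ?mulr1.
  by rewrite 2!exprD -[LHS]mulrA h exprMn mulrC.
by rewrite !exprS; lra.
Qed.

(** * Expected cover time of a single set *)

Section PerSet.
Variables (d : measure_display) (T : measurableType d) (R : realType).
Variables (P : probability T R) (U : finType).
Variables (alpha : {RV P >-> R}) (alpha_ : U -> {RV P >-> R}).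
Hypothesis rand : algorithm_randomness alpha alpha_.
Variables (SS : {set {set U}}) (K : {set U} -> nat).
Variables (x : U -> nat -> R) (y : {set U} -> nat -> R).
Hypotheses (inst : gmssc_instance SS K) (feas : lp_feasible SS K x y).
Variable sigma : T -> #|U|.-tuple U.
Hypothesis out : algorithm_output 3 x alpha alpha_ sigma.
Variable S : {set U}.
Hypothesis SSS : S \in SS.
Variable M : nat.
Hypothesis M4 : (4 < M)%N.

Let M0 : 0 < M%:R :> R. Proof. by rewrite ltr0n; lia. Qed.

Let z3 : 1 <= 3 :> R. Proof. by rewrite ler1n. Qed.

Let lo (j : nat) : R := j%:R / M%:R.
Let hi (j : nat) : R := j.+1%:R / M%:R.
Let high j i e := round_high x y S 3 (lo j) (hi j) i e.
Let low j i e := round_low x y S 3 (hi j) i e.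
Let sat j i := saturated x y S 3 (hi j) i.

Let lo_gt0 j : (4 <= j)%N -> 0 < lo j.
Proof. by move=> j4; rewrite divr_gt0 // ltr0n; lia. Qed.

Let lo_lt_hi j : lo j < hi j.
Proof. by rewrite ltr_pM2r ?invr_gt0 // ltr_nat. Qed.

Let hi_gt0 j : 0 < hi j.
Proof. by rewrite divr_gt0. Qed.

Let hi_le1 j : (j < M)%N -> hi j <= 1.
Proof. by move=> jM; rewrite ler_pdivrMr // mul1r ler_nat. Qed.

Let coef_ge0 j : 0 <= 2 * hi j / M%:R.
Proof. by rewrite divr_ge0 ?mulr_ge0 // ltW. Qed.

(* The events of round 0 carry no failure condition. *)
Definition round_event (j i : nat) (e : U) : set T :=
  if (j < 4)%N then set0 else
  low_count alpha alpha_ `]lo j, hi j]%classic e (high j i e)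
    (if i == 0%N then finset.set0 else S :\: sat j i)%SET (low j i)
    (if i == 0%N then 1%N else (K S - #|sat j i|)%N).

(** Outside this event [alpha] lies in an interval of index at least 4 and all [alpha_e] are at most
    1; inside it the trivial bound [#|U|] on the cover time is used. *)
Definition bad_event : set T :=
  (alpha @^-1` (`]-oo, 4 / M%:R]%classic `|` `]1, +oo[%classic)) `|`
  \big[setU/set0]_(e : U) (alpha_ e @^-1` `]1, +oo[%classic).

Lemma measurable_round_event j i e : measurable (round_event j i e).
Proof.
by rewrite /round_event; case: ifP => // _; exact: measurable_low_count.
Qed.

(** The interval of [alpha] has length [1 / M] and density at most [2 * hi j]; the event that [e] is
    early contributes [high j i e], and the low count contributes the tail bound. *)
Lemma prob_round_event j i e : (4 <= j < M)%N ->
  (P (round_event j i e) <=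
   (2 * hi j / M%:R * (high j i e * round_bound R i))%:E)%E.
Proof.
move=> /andP[j4 jM]; rewrite /round_event ltnNge j4 /=.
have h0 : 0 <= high j i e by exact: (round_high_ge0 feas S (hi j) z3 (lo_gt0 j4)).
have Pj : (P (alpha @^-1` `]lo j, hi j]%classic) <= (2 * hi j / M%:R)%:E)%E.
  apply: le_trans (prob_alpha_le rand (C := 2 * hi j) (D := `]lo j, hi j]%classic) _ _ _ _) _ => //.
  - by move=> v vB _; split=> //; move: vB; rewrite /= in_itv /= => /andP[_ ?]; rewrite ler_wpM2l.
  - by rewrite mulr_ge0 // ltW.
  rewrite lebesgue_measure_itv /= lte_fin lo_lt_hi -EFinD -EFinM lee_fin.
  by rewrite le_eqVlt; apply/orP; left; apply/eqP; rewrite /hi /lo -natr1; ring.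
have bound (r : R) : r <= high j i e * round_bound R i -> 0 <= r ->
    (P (alpha @^-1` `]lo j, hi j]%classic) * r%:E <=
    (2 * hi j / M%:R * (high j i e * round_bound R i))%:E)%E.
  move=> rle r0; apply: (@le_trans _ _ ((2 * hi j / M%:R)%:E * r%:E)%E).
    by rewrite lee_wpmul2r // lee_fin.
  by rewrite -EFinM lee_fin ler_wpM2l.
case: (eqVneq i 0%N) => [i0|i0].
  apply: le_trans (prob_low_count_le rand _ _ h0 _ 1 (ltn0Sn 0)) _ => //.
    by move=> e'; rewrite inE.
  rewrite finset.big_set0 mulr1 expr0 mul1r.
  by apply: bound => //; rewrite /round_bound i0 mulr1.
(* With no residual demand the event is an empty union, as no [J] has fewer than 0 elements. *)
set k := (K S - _)%N; case: (posnP k) => [->|k0].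
  rewrite /low_count big_pred0 // measure0 lee_fin.
  exact: mulr_ge0 (coef_ge0 j) (mulr_ge0 h0 (round_bound_ge0 R i)).
have q01 e' : e' \in (S :\: sat j i)%SET -> 0 <= low j i e' <= 1.
  rewrite !inE => /andP[+ eS]; rewrite eS /= -ltNge => /ltW ->; rewrite andbT.
  exact: (round_low_ge0 feas S z3 (hi_gt0 j)).
(* The parameter [m = 3 * i] is the ratio [i * z] of expected count to residual demand. *)
have m0 : (0 < 3 * i)%N by lia.
apply: le_trans (prob_low_count_le rand _ _ h0 q01 k m0) _ => //.
apply: bound; last first.
  apply: mulr_ge0; first by rewrite exprn_ge0.
  apply: mulr_ge0 => //; apply: prodr_ge0 => e' /q01/andP[q0 q1].
  by rewrite addr_ge0 ?divr_ge0 ?subr_ge0.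
rewrite mulrCA ler_wpM2l // /round_bound (negPf i0).
apply: prod_lower_tail => //.
have := sum_round_low inst feas SSS z3 (hi_gt0 j) (hi_le1 jM) i.
apply: le_trans; rewrite !natrM natrB; last by move: k0; rewrite subn_gt0 => /ltnW.
by rewrite [3 * _]mulrC.
Qed.

(** The constant is [25 = 12 * (5 / 4) * (5 / 3)]: [12] from the density, the doubling and [z = 3];
    [5 / 4] bounds [hi j / lo j] for [j >= 4]; [5 / 3] is the series over the rounds. *)
Lemma sum_prob_round_event j : (4 <= j < M)%N ->
  (\sum_(i < #|U|.+1) \sum_e P (round_event j i e) <=
   (25 / M%:R * (alpha_point y S (hi j))%:R)%:E)%E.
Proof.
move=> jj; have /andP[j4 jM] := jj.
have hl : hi j / lo j <= 5 / 4.
  rewrite ler_pdivrMr ?lo_gt0 // /hi /lo mulrA ler_pM2r ?invr_gt0 // -natr1.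
  by have : 4 <= j%:R :> R; [rewrite ler_nat|lra].
apply: (@le_trans _ _ (\sum_(i < #|U|.+1)
    (2 * hi j / M%:R * (round_bound R i * (2 * (3 / lo j) * (2 ^+ i * (alpha_point y S (hi j))%:R))))%:E)%E).
  apply: lee_sum => i _.
  apply: (@le_trans _ _ (\sum_e (2 * hi j / M%:R * (high j i e * round_bound R i))%:E)%E).
    by apply: lee_sum => e _; exact: prob_round_event.
  rewrite sumEFin lee_fin -mulr_sumr -mulr_suml ler_wpM2l //.
  rewrite mulrC ler_wpM2l ?round_bound_ge0 //.
  exact: (sum_round_high feas S (hi j) z3 (lo_gt0 j4)).
rewrite sumEFin lee_fin.
set t := (alpha_point y S (hi j))%:R.
have -> : \sum_(i < #|U|.+1) 2 * hi j / M%:R * (round_bound R i * (2 * (3 / lo j) * (2 ^+ i * t)))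
    = 12 / M%:R * t * (hi j / lo j) * \sum_(i < #|U|.+1) round_bound R i * 2 ^+ i.
  rewrite mulr_sumr; apply: eq_bigr => i _; ring.
have -> : 25 / M%:R * t = 12 / M%:R * t * (5 / 4) * (5 / 3) by field; rewrite gt_eqF.
have p0 : 0 <= 12 / M%:R * t by rewrite !mulr_ge0 ?invr_ge0 ?ler0n.
have hl0 : 0 <= hi j / lo j by rewrite divr_ge0 // ltW // lo_gt0.
apply: ler_pM; rewrite ?sum_round_bound //.
- by rewrite mulr_ge0.
- by apply: sumr_ge0 => i _; rewrite mulr_ge0 ?round_bound_ge0.
- by rewrite ler_wpM2l.
Qed.

Lemma measurable_bad_event : measurable bad_event.
Proof.
apply: measurableU; first by apply: measurable_RV_preimage; exact: measurableU.
by apply: bigsetU_measurable => e _; exact: measurable_RV_preimage.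
Qed.

(** On [(0, 4 / M]] the density is at most [8 / M]; the remaining parts are null. *)
Lemma prob_bad_event : (P bad_event <= (32 / M%:R ^+ 2)%:E)%E.
Proof.
have mA : measurable (alpha @^-1` (`]-oo, 4 / M%:R]%classic `|` `]1, +oo[%classic)).
  by apply: measurable_RV_preimage; exact: measurableU.
have mE e : measurable (alpha_ e @^-1` `]1, +oo[%classic) by exact: measurable_RV_preimage.
have [mU UE] := probability_bigsetU_le P (index_enum U) xpredT mE.
apply: le_trans (measureU2 _ mA mU) _.
rewrite -[leRHS]adde0; apply: leeD; last first.
  apply: le_trans UE _; apply: sume_le0 => e _.
  have : (P (alpha_ e @^-1` `]1%R, +oo[%classic) <= (1 - 1)%:E)%E; last by rewrite subrr.
  apply: (prob_alpha_e_itv_le rand) => // v /=; rewrite in_itv /= andbT => v1 /andP[_].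
  by rewrite leNgt v1.
have b0 : 0 < 4 / M%:R :> R by rewrite divr_gt0.
apply: le_trans (prob_alpha_le rand (C := 2 * (4 / M%:R)) (D := `[0, 4 / M%:R]%classic) _ _ _ _) _.
- exact: measurableU.
- by [].
- move=> v [] /=; rewrite !in_itv /= ?andbT => v1 /andP[v0 v2].
    by rewrite v1 (ltW v0) ler_wpM2l.
  by have := lt_trans v1 v2; rewrite ltxx.
- by rewrite mulr_ge0 // ltW.
rewrite lebesgue_measure_itv /= lte_fin b0 -EFinD -EFinM lee_fin.
by rewrite le_eqVlt; apply/orP; left; apply/eqP; field; rewrite gt_eqF.
Qed.

(** For the interval [j] of [alpha w] and the round [i] of [cover_time_round], the sum over [e]
    counts the elements with [alpha_ e w <= high j i e], which bounds the cover time. *)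
Lemma cover_time_le_events w :
  (cover_time K (sigma w) S)%:R <=
  #|U|%:R * \1_bad_event w +
  \sum_(j < M) \sum_(i < #|U|.+1) \sum_e \1_(round_event j i e) w :> R.
Proof.
have [_ /(_ w) [us srt]] := out.
have e0 (E : set T) : 0 <= \1_E w :> R by rewrite indicE.
have sum0 : 0 <= \sum_(j < M) \sum_(i < #|U|.+1) \sum_e \1_(round_event j i e) w :> R.
  by do 3 apply: sumr_ge0 => ? _.
have [bad|good] := pselect (bad_event w).
  rewrite [\1_bad_event w]indicE mem_set // mulr1 -[leLHS]addr0 lerD // ler_nat.
  exact: (cover_time_le_card us (inst SSS)).
rewrite [\1_bad_event w]indicE memNset // mulr0 add0r.
have a4 : 4 / M%:R < alpha w.
  by rewrite ltNge; apply/negP => h; apply: good; left; left; rewrite /= in_itv.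
have a1 : alpha w <= 1.
  by rewrite leNgt; apply/negP => h; apply: good; left; right; rewrite /= in_itv /= h.
have u1 e : alpha_ e w <= 1.
  rewrite leNgt; apply/negP => h; apply: good; right.
  by rewrite (bigD1 e) //=; left; rewrite /= in_itv /= h.
have Mp : M.-1.+1 = M by rewrite prednK // (leq_trans _ M4).
have hiM : alpha w <= hi M.-1 by rewrite /hi Mp divff ?gt_eqF.
have exj : exists j, alpha w <= hi j by exists M.-1.
(* Minimality of [j] gives [lo j < alpha w], since [lo j.+1 = hi j]. *)
pose j := ex_minn exj.
have [j4 jM loj hij] : [/\ (4 <= j)%N, (j < M)%N, lo j < alpha w & alpha w <= hi j].
  rewrite /j; case: ex_minnP => {}j hij minj; split => //.
  - rewrite leqNgt; apply/negP => j4.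
    have := lt_le_trans a4 hij; rewrite ltr_pM2r ?invr_gt0 // ltr_nat.
    by rewrite ltnS leqNgt j4.
  - by rewrite -Mp ltnS; exact: minj.
  - case: j hij minj => [|j] hij minj.
      by rewrite /lo mul0r (lt_trans _ a4) // divr_gt0.
    by rewrite ltNge; apply/negP => /minj; rewrite ltnn.
have [i [iU C_le i_low]] := cover_time_round inst feas SSS z3 (lo_gt0 j4)
  (hi_gt0 j) (hi_le1 jM) loj hij u1 us srt.
rewrite (bigD1 (Ordinal jM)) //= -[leLHS]addr0 lerD //; last first.
  by do 3 apply: sumr_ge0 => ? _.
have iU' : (i < #|U|.+1)%N by rewrite ltnS.
rewrite (bigD1 (Ordinal iU')) //= -[leLHS]addr0 lerD //; last first.
  by do 2 apply: sumr_ge0 => ? _.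
apply: (@le_trans _ _ (#|[set e | (alpha_ e w <= high j i e)%R]%SET|%:R)).
  by rewrite ler_nat.
rewrite -sum1_card natr_sum big_mkcond; apply: ler_sum => e _.
rewrite inE; case: ifP => // ue.
rewrite indicE mem_set // /round_event ltnNge j4 /=.
apply: low_countP => //; first by rewrite /= in_itv /= loj hij.
case: eqVneq i_low => [_ _|i0 [i0'|//]]; last by rewrite i0' eqxx in i0.
by rewrite ltnS leqn0 cards_eq0; apply/eqP/setP => e'; rewrite !inE.
Qed.

(** The error constant is [57 = 25 + 32]: [25] from rounding in the Riemann sum, [32] from the bad
    event. *)
Lemma expectation_cover_time_le :
  ('E_P[fun w => (cover_time K (sigma w) S)%:R] <=
   (25 * (\sum_(1 <= t < #|U|.+1) (1 - y S t)) + 57 * #|U|%:R / M%:R)%:E)%E.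
Proof.
pose I := option ('I_M * ('I_#|U|.+1 * U)).
pose c (t : I) : R := if t is None then #|U|%:R else 1.
pose E (t : I) : set T := if t is Some p then round_event p.1 p.2.1 p.2.2 else bad_event.
apply: (@le_trans _ _ (\sum_t (c t)%:E * P (E t))%E).
  apply: expectation_le_events => //.
  - by apply: (measurable_fun_of_finite (fun s => (cover_time K s S)%:R)); case: out.
  - by case=> [p|] /=; rewrite /c.
  - by case=> [p|] /=; [exact: measurable_round_event|exact: measurable_bad_event].
  - move=> w; rewrite big_option /=; apply: le_trans (cover_time_le_events w) _.
    rewrite lerD2l; under [leRHS]eq_bigr do rewrite mul1r.
    rewrite -(pair_bigA _ (fun (j : 'I_M) (p : 'I_#|U|.+1 * U) => \1_(round_event j p.1 p.2) w)) /=.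
    apply: ler_sum => j _.
    by rewrite -(pair_bigA _ (fun (i : 'I_#|U|.+1) e => \1_(round_event j i e) w)).
rewrite big_option /=.
have -> : (\sum_(p : 'I_M * ('I_#|U|.+1 * U)) 1%:E * P (round_event p.1 p.2.1 p.2.2) =
  \sum_(j < M) \sum_(i < #|U|.+1) \sum_e P (round_event j i e))%E.
  under eq_bigr do rewrite mul1e.
  rewrite -(pair_bigA _ (fun (j : 'I_M) (p : 'I_#|U|.+1 * U) => P (round_event j p.1 p.2))) /=.
  apply: eq_bigr => j _.
  by rewrite -(pair_bigA _ (fun (i : 'I_#|U|.+1) e => P (round_event j i e))).
apply: (@le_trans _ _ (#|U|%:R%:E * (32 / M%:R ^+ 2)%:E +
   \sum_(j < M) (25 / M%:R * (alpha_point y S (hi j))%:R)%:E)%E).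
  apply: leeD; first by rewrite lee_wpmul2l ?lee_fin // prob_bad_event.
  apply: lee_sum => j _; have [j4|j4] := leqP 4 j.
    by apply: sum_prob_round_event; rewrite j4 ltn_ord.
  rewrite big1 ?lee_fin ?mulr_ge0 ?invr_ge0 // => i _; rewrite big1 // => e _.
  by rewrite /round_event j4 measure0.
rewrite sumEFin -EFinM -EFinD lee_fin -mulr_sumr.
have := sum_alpha_point feas SSS (ltn_trans (ltn0Sn 3) M4).
rewrite natr_sum big_mkord => sum_le.
have k0 : 0 <= 25 / M%:R :> R by rewrite divr_ge0.
have := ler_wpM2l k0 sum_le.
set L := \sum_(1 <= t < _) _.
have -> : 25 / M%:R * (M%:R * L + #|U|%:R) = 25 * L + 25 * #|U|%:R / M%:R.
  by field; rewrite gt_eqF.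
move=> le1.
have : #|U|%:R * (32 / M%:R ^+ 2) <= 32 * #|U|%:R / M%:R :> R.
  rewrite [leLHS](_ : _ = 32 * #|U|%:R / M%:R / M%:R); last by field; rewrite gt_eqF.
  rewrite ler_pdivrMr // ler_peMr ?divr_ge0 ?mulr_ge0 //.
  by rewrite ler1n; lia.
lra.
Qed.

End PerSet.

(** * Summing over all sets and comparing with the optimum *)

Lemma expectation_cost (d : measure_display) (T : measurableType d)
    (R : realType) (P : probability T R) (U : finType) (SS : {set {set U}})
    (K : {set U} -> nat) (sigma : T -> #|U|.-tuple U) :
  (forall s, measurable (sigma @^-1` [set s])) ->
  ('E_P[fun w => (cost SS K (sigma w))%:R] =
   \sum_(S in SS) 'E_P[fun w => (cover_time K (sigma w) S)%:R] :> \bar R)%E.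
Proof.
move=> ms; rewrite unlock.
under eq_integral do rewrite /cost natr_sum -sumEFin -big_enum.
rewrite ge0_integral_sum ?big_enum //.
move=> S; apply/measurable_EFinP.
by apply: (measurable_fun_of_finite (fun s => (cover_time K s S)%:R)).
Qed.

Theorem theorem1 (R : realType) :
  exists z rho : R, 0 < z /\ rho < 2778%:R / 100%:R /\
  forall (U : finType) (SS : {set {set U}}) (K : {set U} -> nat)
    (xstar : U -> nat -> R) (ystar : {set U} -> nat -> R)
    (d : measure_display) (T : measurableType d) (P : probability T R)
    (alpha : {RV P >-> R}) (alpha_ : U -> {RV P >-> R})
    (sigma : T -> #|U|.-tuple U),
  gmssc_instance SS K ->
  lp_optimal SS K xstar ystar ->
  algorithm_randomness alpha alpha_ ->
  algorithm_output z xstar alpha alpha_ sigma ->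
  ('E_P[fun w => (cost SS K (sigma w))%:R] <= (rho * (OPT SS K)%:R)%:E)%E.
Proof.
exists 3, 25; split => //; split; first by lra.
move=> U SS K x y d T P alpha alpha_ sigma inst opt rand out.
have [feas _] := opt; have [ms _] := out.
rewrite (expectation_cost P SS K ms); apply/lee_addgt0Pr => eps eps0.
set N : R := #|SS|%:R * (57 * #|U|%:R).
have N0 : 0 <= N by rewrite !mulr_ge0.
(* The number of intervals is free: exceeding [N / eps] makes the total error at most [eps], and the
   added 5 ensures [4 < M]. *)
pose M := (Num.trunc (N / eps)).+4.+1.
have M0 : 0 < M%:R :> R by rewrite ltr0n.
have NM : N / M%:R <= eps.
  have /andP[_ /ltW lt] := Num.Theory.trunc_itv (divr_ge0 N0 (ltW eps0)).
  rewrite ler_pdivrMr // mulrC -ler_pdivrMr // (le_trans lt) // ler_nat.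
  by rewrite /M !ltnS -addn4 leq_addr.
apply: (@le_trans _ _ (\sum_(S in SS)
    (25 * (\sum_(1 <= t < #|U|.+1) (1 - y S t)) + 57 * #|U|%:R / M%:R)%:E)%E).
  by apply: lee_sum => S SSS; exact: (expectation_cover_time_le rand inst feas out SSS).
rewrite sumEFin -EFinD lee_fin big_split /= -mulr_sumr exchange_big /=.
rewrite -/(lp_value SS y) sumr_const -[_ *+ #|SS|]mulr_natl mulrA.
by rewrite lerD // ler_wpM2l // (lp_value_le_OPT inst opt).
Qed.
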